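(* Let $X=\prod_{\alpha\in A}X_\alpha$ be such that each factor $X_\alpha$ is a separable $W$-space of G. Then any tail set having the property of Baire in $X$ is either meager or residual in $X$.
   Context: No separation axioms are assumed. For a space $S$ and $x\in S$, a $\mathscr{G}_x(S)$-play is a sequence $\{(x_i,W_i)\}_{i=1}^\infty$ with $x_1=x$, each $W_i$ an open neighborhood of $x$, and $x_{i+1}\in W_i$ for all $i$; Player $\beta$ moves first and picks the $x_i$, Player $\alpha$ picks the $W_i$, alternately. Player $\alpha$ wins the play if $x$ is a cluster point of the sequence $\{x_i\}$ (every neighborhood of $x$ contains $x_i$ for infinitely many indices $i$). $S$ is a $W$-space of G (Gruenhage) if for every $x\in S$ Player $\alpha$ has a winning strategy in the $\mathscr{G}_x(S)$-game. A set $E\subset\prod_{\alpha\in A}X_\alpha$ is a tail set if whenever $x=(x_\alpha)$ and $y=(y_\alpha)$ are points of the product with $x_\alpha=y_\alpha$ for all but finitely many $\alpha$, then $E$ contains both $x$ and $y$ or neither. A set is meager if it is a countable union of sets whose closures have empty interior, and residual if its complement is meager. $E\subseteq X$ has the property of Baire if $E=G\vartriangle P$ (symmetric difference) with $G$ open and $P$ meager in $X$. *)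

(* Defs.v *)
From HB Require Import structures.
From mathcomp Require Import all_boot all_order all_algebra.
From mathcomp Require Import all_classical all_reals all_analysis.

Set Implicit Arguments.
Unset Strict Implicit.
Unset Printing Implicit Defensive.

Local Open Scope classical_set_scope.

Section Category.
Context {T : topologicalType}.
Implicit Types E : set T.

Definition separable : Prop := exists2 D : set T, countable D & dense D.

Definition nowhere_dense E : Prop := interior (closure E) = set0.

Definition meager E : Prop :=
  exists2 F : nat -> set T,
    forall n, nowhere_dense (F n) & E = \bigcup_n F n.

Definition residual E : Prop := meager (~` E).

Definition baire_property E : Prop :=
  exists G P : set T, [/\ open G, meager P & E = G `+` P].

End Category.
Arguments separable : clear implicits.

Section Game.
Context {S : topologicalType}.
Implicit Types (x : S) (xs : nat -> S) (W : nat -> set S).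

(* Rounds are numbered from 0: beta's first move is [xs 0], which is [x]. *)
Definition is_play x xs W : Prop :=
  xs 0%N = x /\ forall i, open_nbhs x (W i) /\ W i (xs i.+1).

Definition alpha_wins x xs : Prop :=
  forall U, nbhs x U -> infinite_set [set i | U (xs i)].

(* A strategy for alpha answers the finite sequence of all the points chosen  *)
(* so far by beta; alpha's own earlier moves are determined by that sequence. *)
Definition alpha_strategy x (sigma : seq S -> set S) : Prop :=
  forall s, open_nbhs x (sigma s).

Definition follows (sigma : seq S -> set S) xs W : Prop :=
  forall i, W i = sigma (mkseq xs i.+1).

Definition winning_strategy x (sigma : seq S -> set S) : Prop :=
  alpha_strategy x sigma /\
  forall xs W, is_play x xs W -> follows sigma xs W -> alpha_wins x xs.

End Game.

Definition W_space (S : topologicalType) : Prop :=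
  forall x : S, exists sigma, winning_strategy x sigma.

Definition tail_set {A : Type} {X : A -> Type} (E : set (forall a, X a)) :
    Prop :=
  forall x y : forall a, X a,
    finite_set [set a | x a <> y a] -> (E x <-> E y).

(* Main.v *)
Require Import Defs.
From mathcomp Require Import all_boot all_order all_algebra.
From mathcomp Require Import all_classical all_reals all_analysis.

(** A tail set [E] is, for each coordinate [i], a product of the whole factor
    [K i] with a subset of the product of the other factors.  If the factors
    satisfy a Kuratowski-Ulam theorem, then a product [W * S'] in
    [K i * Z] can be meager only if [W] or [S'] is.  Applied to the finitely
    many coordinates that constrain a basic box, one after another, this shows
    that a tail set whose intersection with some nonmeager basic box is meager
    is itself meager ([meager_from_box]).

    Write [E] as the symmetric difference of an open [G] and a meager [P].  If
    [G] is meager, so is [E].  Otherwise, by the Banach category theorem (any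
    union of open meager sets is meager, [meager_bigcup_open]), some basic box
    inside [G] is nonmeager.  The complement of [E] is a tail set that meets
    this box within [P], so it is meager.

    The usual proof of the Kuratowski-Ulam theorem runs through a countable
    pi-base of one factor: if a section of an open set meets every member of
    the pi-base, it is dense.  A countable family of nonempty open sets [W]
    such that each nonempty open [U] has some [W] within the closure of [U]
    does as well, because an open set that meets [W] then meets [U].  A
    separable W-space has such a family: the answers of winning strategies to
    the finite sequences in a countable dense set [D].  Indeed, let [d] lie in
    [D] and in the open set [U]; if every answer contained a point of [D]
    outside [U], then beta could play such points forever, and the play would
    return to [U] only at its start ([winning_strategy_trap]). *)

Set Implicit Arguments.
Unset Strict Implicit.
Unset Printing Implicit Defensive.

Local Open Scope classical_set_scope.

(** * Meager sets and the Banach category theorem *)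

Section Meager.
Context {T : topologicalType}.
Implicit Types E U V W : set T.

(** The local form, with an open set in place of the closure and the interior,
    is the one in which witnesses can be moved along open maps, sections and
    disjoint unions. *)
Lemma nowhere_denseP E :
  nowhere_dense E <-> forall V, open V -> V !=set0 ->
    exists W, [/\ open W, W !=set0, W `<=` V & forall x, W x -> ~ E x].
Proof.
split=> [ndE V oV [x Vx]|locE].
- have [y [Vy ncEy]] : exists y, V y /\ ~ closure E y.
    apply: contrapT => /forallNP VcE.
    suff: interior (closure E) x by rewrite ndE.
    rewrite /interior nbhsE; exists V => // y Vy.
    by apply: contrapT => ncEy; exact: (VcE y).
  exists (V `&` ~` closure E); split.
  + by apply: openI => //; rewrite openC; exact: closed_closure.
  + by exists y.
  + by move=> z [].
  + by move=> z [_ ncEz] /(@subset_closure _ E).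
- rewrite /nowhere_dense -subset0 => x Ex.
  have [|W [oW [y Wy] sW WE]] := locE (interior (closure E)) (open_interior _).
    by exists x.
  have [z [Ez Wz]] : E `&` W !=set0.
    by apply: (interior_subset (sW _ Wy)); exact: open_nbhs_nbhs.
  exact: (WE z).
Qed.

Lemma nowhere_denseS E E' : E `<=` E' -> nowhere_dense E' -> nowhere_dense E.
Proof.
move=> sEE' /nowhere_denseP ndE'; apply/nowhere_denseP => V oV V0.
have [W [oW W0 WV WE']] := ndE' V oV V0.
by exists W; split=> // x Wx /sEE'; exact: WE'.
Qed.

Lemma nowhere_dense0 : nowhere_dense (set0 : set T).
Proof. by rewrite /nowhere_dense closure0 interior0. Qed.

Lemma meager_cover (F : nat -> set T) E :
  (forall n, nowhere_dense (F n)) -> E `<=` \bigcup_n F n -> meager E.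
Proof.
move=> ndF sEF; exists (fun n => F n `&` E).
  by move=> n; apply: nowhere_denseS (ndF n) => x [].
by rewrite -setI_bigcupl setIC; apply/esym/setIidl.
Qed.

Lemma meagerS E E' : E `<=` E' -> meager E' -> meager E.
Proof. by move=> sEE' [F ndF E'F]; apply: meager_cover ndF _; rewrite -E'F. Qed.

Lemma nowhere_dense_meager E : nowhere_dense E -> meager E.
Proof. by move=> ndE; apply: (@meager_cover (fun=> E)) => // x; exists 0%N. Qed.

Lemma meager_bigcup (I : Type) (D : set I) (F : I -> set T) :
  countable D -> (forall i, D i -> meager (F i)) ->
  meager (\bigcup_(i in D) F i).
Proof.
move=> /countable_injP[g g_inj] mF.
have /choice[N NP] : forall i, exists N : nat -> set T,
    D i -> (forall n, nowhere_dense (N n)) /\ F i = \bigcup_n N n.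
  move=> i; have [Di|nDi] := pselect (D i); last by exists (fun=> set0).
  by have [N ndN FE] := mF i Di; exists N.
(* One index codes a member of the family, through the injection [g], and the
   position of a nowhere dense piece of that member. *)
pose H m := [set x | if unpickle m is Some (k, n) then
  exists i, [/\ D i, g i = k & N i n x] else False].
apply: (@meager_cover H) => [m|x [i Di]].
- rewrite /H; case: unpickle => [[k n]|]; last exact: nowhere_dense0.
  have [[i [Di gik]]|noi] := pselect (exists i, D i /\ g i = k).
    apply: nowhere_denseS (proj1 (NP i Di) n) => x [j [Dj gjk Njx]].
    by rewrite (g_inj i j) ?inE // gik gjk.
  apply: nowhere_denseS nowhere_dense0 => x [j [Dj gjk _]].
  by apply: noi; exists j.
- rewrite (proj2 (NP i Di)) => -[n _ Nx].
  by exists (pickle (g i, n)) => //; rewrite /H /= pickleK; exists i.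
Qed.

Lemma meagerU E E' : meager E -> meager E' -> meager (E `|` E').
Proof.
move=> mE mE'; rewrite -bigcup2E; apply: meager_bigcup => // -[|[|n]] _ //=.
exact/nowhere_dense_meager/nowhere_dense0.
Qed.

(** The Banach category theorem.  Over a maximal disjoint family [M] of open
    meager sets, the [n]-th nowhere dense pieces of all members can be merged:
    inside a member of [M] only its own piece is seen, so the union of the
    pieces is nowhere dense.  By maximality, whatever an open meager set has
    outside the union of [M] lies in the boundary of that union. *)
Lemma meager_bigcup_open :
  meager (\bigcup_(U in [set U : set T | open U /\ meager U]) U).
Proof.
have [M [sM tM maxM]] := ex_maximal_disjoint_subcollection (@id (set T))
  [set U : set T | open U /\ meager U].
pose O := \bigcup_(U in M) U.
have oO : open O by apply: bigcup_open => U /sM[].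
have mO : meager O.
  have /choice[N NP] : forall U, exists N : nat -> set T,
      M U -> (forall n, nowhere_dense (N n)) /\ U = \bigcup_n N n.
    move=> U; have [MU|nMU] := pselect (M U); last by exists (fun=> set0).
    by have [_ [N ndN UE]] := sM U MU; exists N.
  apply: (@meager_cover (fun n => \bigcup_(U in M) N U n)) => [n|x [U MU]].
  - apply/nowhere_denseP => V oV V0.
    have [[x [Vx [U MU Ux]]]|nVO] := pselect (V `&` O !=set0); last first.
      exists V; split=> // x Vx [U MU NUx]; apply: nVO; exists x; split=> //.
      by exists U => //; rewrite (proj2 (NP U MU)); exists n.
    have [oU _] := sM U MU.
    have /nowhere_denseP ndU := proj1 (NP U MU) n.
    have [|W [oW W0 sW WN]] := ndU (V `&` U) (openI oV oU); first by exists x.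
    exists W; split=> // [y /sW[] //|y Wy [U' MU' NU'y]].
    have U'y : U' y by rewrite (proj2 (NP U' MU')); exists n.
    have UU' : U = U' by apply: tM => //; exists y; split=> //; case/sW: Wy.
    by apply: (WN y Wy); rewrite UU'.
  - by rewrite {1}(proj2 (NP U MU)) => -[n _ NUx]; exists n => //; exists U.
apply: (@meagerS _
  (O `|` (\bigcup_(U in [set U | open U /\ meager U]) U `\` O))).
  by move=> x Ux; have [Ox|nOx] := pselect (O x); [left|right].
apply: meagerU => //; apply/nowhere_dense_meager/nowhere_denseP => V oV V0.
have [VO0|nVO] := pselect (V `&` O !=set0).
  by exists (V `&` O); split=> //; [exact: openI|by move=> x [_ Ox] [_]].
exists V; split=> // x Vx [[U [oU mU] Ux] nOx].
have VUO y : (V `&` U) y -> O y -> False.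
  by move=> [Vy _] Oy; apply: nVO; exists y.
(* [V `&` U] could be added to [M]. *)
apply: (maxM (M `|` [set V `&` U])).
- split=> [W MW|sM']; first by left.
  by apply: (VUO x) => //; exists (V `&` U) => //; apply: sM'; right.
- move=> W [/sM //|->]; split; first exact: openI.
  by apply: meagerS mU => y [].
- move=> W W' [MW|->] [MW'|->] //.
  + exact: tM.
  + by move=> [y [Wy /VUO VUy]]; exfalso; apply: VUy; exists W.
  + by move=> [y [/VUO VUy Wy]]; exfalso; apply: VUy; exists W'.
Qed.

End Meager.

(** * Separable W-spaces *)

(** A weak form of a countable pi-base.  Only the closure of [U] can be reached:
    what a winning strategy controls is the trace of its answer on a dense
    set. *)
Definition countable_closure_base (T : topologicalType) : Prop :=
  exists B : set (set T), [/\ countable B,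
    forall W, B W -> open W /\ W !=set0 &
    forall U, open U -> U !=set0 -> exists2 W, B W & W `<=` closure U].

Lemma countable_seqs (T : choiceType) (D : set T) :
  countable D -> countable [set s : seq T | {in s, forall x, D x}].
Proof.
move=> /countable_injP[g g_inj]; apply/countable_injP.
exists (fun s => pickle (map g s)) => s t; rewrite !inE /= => Ds Dt.
move=> /(pcan_inj pickleK).
elim: s t Ds Dt => [|x s IH] [|y t] //= Ds Dt [gxy st].
congr (_ :: _); last first.
  by apply: IH st => z zs; [apply: Ds|apply: Dt]; rewrite inE zs orbT.
by apply: g_inj; rewrite ?inE //; [apply: Ds|apply: Dt]; rewrite inE eqxx.
Qed.

(** If no answer of alpha to points of [D] had its trace on [D] inside [U],
    beta could pick all points but the first outside [U], and [d] would not be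
    a cluster point of the play. *)
Lemma winning_strategy_trap (T : topologicalType) (D U : set T) (d : T) sigma :
  winning_strategy d sigma -> D d -> open U -> U d ->
  exists2 r, {in r, forall x, D x} & sigma (d :: r) `&` D `<=` U.
Proof.
move=> [stratS winS] Dd oU Ud; apply: contrapT => /forall2NP noR.
have /choice[pick pickP] : forall r, exists y, {in r, forall x, D x} ->
    [/\ sigma (d :: r) y, D y & ~ U y].
  move=> r; have [nDr|] := noR r; first by exists d.
  by move=> /existsNP[y /not_implyP[[sy Dy] nUy]]; exists y.
(* [R n] lists the moves 1 to [n] of beta; move 0 is forced to be [d]. *)
pose R n := iter n (fun r => rcons r (pick r)) [::].
have DR n : {in R n, forall x, D x}.
  elim: n => [//|n IH] x /=; rewrite mem_rcons inE => /orP[/eqP->|/IH//].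
  by have [] := pickP _ IH.
pose xs n := if n is m.+1 then pick (R m) else d.
have xsR n : mkseq xs n.+1 = d :: R n.
  by elim: n => [//|n IH]; rewrite mkseqS IH.
have /(_ U) : alpha_wins d xs.
  apply: (winS xs (fun n => sigma (d :: R n))) => [|i]; last by rewrite xsR.
  by split=> // i; split; [exact: stratS|have [] := pickP _ (DR i)].
apply; first exact: open_nbhs_nbhs.
apply: (@sub_finite_set _ _ [set 0%N]); last exact: finite_set1.
by move=> [//|i] /= Ui; have [_ _] := pickP _ (DR i).
Qed.

Lemma separable_W_space_base (T : topologicalType) :
  separable T -> W_space T -> countable_closure_base T.
Proof.
move=> [D cD dD] /choice[sigma sigmaP].
exists (\bigcup_(d in D) [set sigma d (d :: r) | r in
  [set r : seq T | {in r, forall x, D x}]]); split.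
- apply: bigcup_countable => // d Dd.
  exact: sub_countable (card_image_le _ _) (countable_seqs cD).
- move=> W [d Dd [r _ <-]]; have [/(_ (d :: r))[? ?] _] := sigmaP d.
  by split=> //; exists d.
- move=> U oU U0; have [d [Ud Dd]] := dD U U0 oU.
  have [r Dr sU] := winning_strategy_trap (sigmaP d) Dd oU Ud.
  exists (sigma d (d :: r)); first by exists d => //; exists r.
  have [/(_ (d :: r))[oW _] _] := sigmaP d.
  move=> x Wx V; rewrite nbhsE => -[V' [oV' V'x] sV'].
  have [|y [[V'y Wy] Dy]] := dD (V' `&` sigma d (d :: r)) _ (openI oV' oW).
    by exists x.
  by exists y; split; [apply: sU|apply: sV'].
Qed.

(** * Boxes in a product *)

Section Product.
Context {I : eqType} {K : I -> topologicalType}.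
Implicit Types (S : set (prod_topology K)) (f : forall i, set (K i)).

Definition box f : set (prod_topology K) := [set x | forall i, f i (x i)].

Definition cylinder i (W : set (K i)) : set (prod_topology K) := proj i @^-1` W.

Lemma open_cylinder i (W : set (K i)) : open W -> open (cylinder W).
Proof.
by move=> oW; apply: open_comp => // x _; exact: proj_continuous.
Qed.

(** The list bounds the support of the box; it drives the induction that
    frees the coordinates one by one. *)
Definition basic_box (s : seq I) f :=
  (forall i, open (f i)) /\ (forall i, i \notin s -> f i = setT).

Lemma box_split f i : box f = box (dfwith f i setT) `&` cylinder (f i).
Proof.
apply/seteqP; split=> [x fx|x [fx fi] j].
  by split=> [j|]; [case: dfwithP|exact: fx].
by have [<-//|/eqP ij] := pselect (i = j); have := fx j; rewrite dfwithout.
Qed.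

Lemma basic_box_dfwith i s f :
  basic_box (i :: s) f -> basic_box s (dfwith f i setT).
Proof.
move=> [of_ fT]; split=> j; first by case: dfwithP => //; exact: openT.
move=> js; have [<-|ij] := eqVneq i j; first by rewrite dfwithin.
by rewrite dfwithout // fT // inE negb_or eq_sym ij.
Qed.

Lemma open_box s f : basic_box s f -> open (box f).
Proof.
elim: s f => [|i s IH] f bf.
  have -> : box f = setT by apply/seteqP; split=> // x _ i; rewrite (proj2 bf).
  exact: openT.
rewrite (box_split f i); apply: openI; first exact/IH/basic_box_dfwith.
by apply: open_cylinder; exact: (proj1 bf).
Qed.

(** The sets containing a basic box around [x] form a filter, and it converges
    to [x] because it does so in each coordinate. *)
Lemma basic_box_nbhs (G : set (prod_topology K)) x : open G -> G x ->
  exists s f, [/\ basic_box s f, box f x & box f `<=` G].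
Proof.
move=> oG Gx.
pose F : set_system (prod_topology K) := [set A |
  exists s f, [/\ basic_box s f, box f x & box f `<=` A]].
have FF : Filter F.
  split.
  - by exists [::], (fun=> setT); split=> //; split=> // i; exact: openT.
  - move=> A B [s [f [[of_ fT] fx fA]]] [t [g [[og gT] gx gB]]].
    exists (s ++ t), (fun i => f i `&` g i); split.
    + split=> i; first exact: openI.
      by rewrite mem_cat negb_or => /andP[/fT-> /gT->]; rewrite setIT.
    + by move=> i; split; [exact: fx|exact: gx].
    + by move=> y fgy; split; [apply: fA|apply: gB] => i; case: (fgy i).
  - by move=> A B sAB [s [f [bf fx fA]]]; exists s, f; split=> // y /fA/sAB.
suff : F --> x by apply; exact: open_nbhs_nbhs.
apply/cvg_sup => i A; rewrite nbhsE => -[_ [[N oN <-] Nx] sA].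
exists [:: i], (dfwith (fun=> setT) i N); split.
- split=> j; first by case: dfwithP => //; move=> *; exact: openT.
  by rewrite inE eq_sym => ij; rewrite dfwithout.
- by move=> j; case: dfwithP.
- by move=> y /(_ i); rewrite dfwithin => Ny; exact: sA.
Qed.

(** * Changing one coordinate *)

Definition set_coord i (t : K i) (x : prod_topology K) : prod_topology K :=
  dfwith x i t.

Lemma set_coord_in i (t : K i) x : set_coord t x i = t.
Proof. exact: dfwithin. Qed.

Lemma set_coord_out i (t : K i) x j : i != j -> set_coord t x j = x j.
Proof. exact: dfwithout. Qed.

Lemma set_coord_set i (t u : K i) x :
  set_coord u (set_coord t x) = set_coord u x.
Proof.
apply: functional_extensionality_dep => j; have [<-|ij] := eqVneq i j.
  by rewrite !set_coord_in.
by rewrite !set_coord_out.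
Qed.

Lemma set_coord_id i (x : prod_topology K) : set_coord (x i) x = x.
Proof.
by apply: functional_extensionality_dep => j; rewrite /set_coord; case: dfwithP.
Qed.

Lemma open_set_coord i (t : K i) (G : set (prod_topology K)) :
  open G -> open (set_coord t @^-1` G).
Proof.
move=> oG; rewrite openE => x /= Gx.
have [s [f [bf fx fG]]] := basic_box_nbhs oG Gx.
have fit : f i t by have := fx i; rewrite set_coord_in.
rewrite /interior nbhsE; exists (box (dfwith f i setT)).
  split.
    apply: (@open_box s); apply: basic_box_dfwith; case: bf => of_ fT.
    by split=> // j; rewrite inE negb_or => /andP[_ /fT].
  move=> j; have [<-|ij] := eqVneq i j; first by rewrite dfwithin.
  by have := fx j; rewrite set_coord_out // dfwithout.
move=> y fy; apply: fG => j; have := fy j.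
have [<- _|ij] := eqVneq i j; first by rewrite set_coord_in.
by rewrite set_coord_out // dfwithout.
Qed.

Lemma open_section i (x : prod_topology K) (G : set (prod_topology K)) :
  open G -> open ((fun t : K i => set_coord t x) @^-1` G).
Proof.
have /continuousP cx : continuous (dfwith x i : K i -> prod_topology K).
  exact: dfwith_continuous.
exact: cx.
Qed.

(** Equivalently, [S] is the product of [K i] with a subset of the product of
    the remaining factors. *)
Definition coordinate_free i S := forall x (t : K i), S x -> S (set_coord t x).

Lemma meager_proj i (E : set (K i)) : meager E -> meager (cylinder E).
Proof.
move=> [N ndN ->].
apply: (@meager_cover _ (fun n => cylinder (N n))) => [n|x [n _ Nx]]; last first.
  by exists n.
apply/nowhere_denseP => V oV [x Vx].
have /nowhere_denseP/(_ (proj i @` V)) := ndN n.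
case; [exact: proj_open|by exists (x i); exists x|].
move=> W [oW [t Wt] sW WN]; have [y Vy yt] := sW t Wt.
exists (V `&` cylinder W); split.
- by apply: openI => //; exact: open_cylinder.
- by exists y; split=> //; rewrite /cylinder /= yt.
- by move=> z [].
- by move=> z [_ /WN].
Qed.

(** A case of the Kuratowski-Ulam theorem: [cylinder W `&` S] is the product of
    [W] with a subset of the other factors.  Let it be covered by nowhere dense
    sets [N n], and let [O n] be the complements of their closures.  For fixed
    [V] in the base, the points [x] for which the section of [O n] through [x]
    in direction [i] meets [V] form a dense open set [R n V].  If [x] lies in
    all of them, the sections of the [O n] through [x] are dense; if moreover
    [x] lies in [S], their complements cover [W], which is nonmeager.  So each
    point of [S] lies in one of the countably many nowhere dense sets
    [~` R n V]. *)
Lemma meager_coordinate_free i S (W : set (K i)) :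
  countable_closure_base (K i) -> coordinate_free i S -> open W ->
  ~ meager (cylinder W) -> meager (cylinder W `&` S) -> meager S.
Proof.
move=> [B [cB oB Bbase]] freeS oW nmW [N ndN WSE].
pose O n := ~` closure (N n).
have oO n : open (O n) by rewrite openC; exact: closed_closure.
pose R n (V : set (K i)) : set (prod_topology K) :=
  [set x | exists2 t, V t & O n (set_coord t x)].
have ndR n V : B V -> nowhere_dense (~` R n V).
  move=> /oB[oV [v Vv]]; apply/nowhere_denseP => G oG [x Gx].
  have oRG : open (G `&` R n V).
    apply: openI => //; have -> : R n V = \bigcup_(t in V)
        set_coord t @^-1` O n.
      by apply/seteqP; split=> y [t]; exists t.
    by apply: bigcup_open => t _; exact: open_set_coord.
  exists (G `&` R n V); split=> //; last by move=> y [_ Ry].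
  (* Some point of [O n] has its [i]-th coordinate in [V] and falls into [G]
     when that coordinate is reset to [x i]; the reset point is in [R n V]. *)
  pose G' := set_coord (x i) @^-1` G.
  have oG' : open (G' `&` cylinder V).
    by apply: openI; [exact: open_set_coord|exact: open_cylinder].
  have /nowhere_denseP/(_ _ oG') := ndN n.
  case=> [|P [oP [y Py] sP PN]].
    exists (set_coord v x); rewrite /G'; split=> /=.
      by rewrite set_coord_set set_coord_id.
    by rewrite /cylinder /= /proj set_coord_in.
  have [G'y Vy] := sP y Py; exists (set_coord (x i) y); split=> //.
  exists (y i) => //; rewrite set_coord_set set_coord_id => cNy.
  have [z [Nz Pz]] : N n `&` P !=set0 by apply: cNy; exact: open_nbhs_nbhs.
  exact: (PN z).
apply: (@meagerS _ _ (\bigcup_n \bigcup_(V in B) ~` R n V)); last first.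
  apply: meager_bigcup => // n _; apply: meager_bigcup => // V BV.
  exact/nowhere_dense_meager/ndR.
move=> x Sx; apply: contrapT => nRx.
have Rx n V : B V -> R n V x.
  by move=> BV; apply: contrapT => nR; apply: nRx; exists n => //; exists V.
apply: nmW; apply: meager_proj.
apply: (@meager_cover _
  (fun n => (fun t : K i => set_coord t x) @^-1` closure (N n))); last first.
  move=> t Wt; have : (cylinder W `&` S) (set_coord t x).
    by split; [rewrite /cylinder /= /proj set_coord_in|exact: freeS].
  by rewrite WSE => -[n _ Nt]; exists n => //; exact: subset_closure.
move=> n; apply/nowhere_denseP => U oU U0.
have oOx : open ((fun t : K i => set_coord t x) @^-1` O n).
  exact: open_section.
exists (U `&` (fun t : K i => set_coord t x) @^-1` O n); split.
- exact: openI.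
- have [V BV sV] := Bbase U oU U0; have [t Vt Ot] := Rx n V BV.
  have [|u [Uu Ou]] := sV t Vt ((fun t : K i => set_coord t x) @^-1` O n).
    exact: open_nbhs_nbhs.
  by exists u.
- by move=> z [].
- by move=> z [].
Qed.

(** The list of constrained coordinates is shortened by one at each step:
    [S] intersected with the box that ignores coordinate [i] does not depend on
    [i], so the previous lemma removes the constraint at [i]. *)
Lemma meager_from_box s f S :
  (forall i, countable_closure_base (K i)) -> (forall i, coordinate_free i S) ->
  basic_box s f -> ~ meager (box f) -> meager (box f `&` S) -> meager S.
Proof.
move=> cbK freeS; elim: s f => [|i s IH] f bf nmf mfS.
  by apply: meagerS mfS => x Sx; split=> // i; rewrite (proj2 bf).
have bf' := basic_box_dfwith bf.
apply: (IH _ bf'); first by apply: contra_not nmf; apply: meagerS;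
  rewrite (box_split f i) => x [].
apply: (@meager_coordinate_free i _ (f i)) => //.
- move=> x t [fx Sx]; split; last exact: freeS.
  move=> j; have := fx j.
  have [<-|ij] := eqVneq i j; first by rewrite !dfwithin.
  by rewrite set_coord_out // !dfwithout.
- by have [] := bf.
- by apply: contra_not nmf; apply: meagerS; rewrite (box_split f i) => x [].
- by rewrite setIA [X in X `&` _]setIC -box_split.
Qed.

End Product.

(** * The zero-one law *)

Theorem theorem6p2p6 (A : Type) (X : A -> topologicalType)
    (sepX : forall a : A, separable (X a))
    (WX : forall a : A, W_space (X a))
    (E : set (prod_topology X))
    (tailE : tail_set E)
    (baireE : baire_property E) :
  meager E \/ residual E.
Proof.
have [G [P [oG mP EGP]]] := baireE.
have [mG|nmG] := pselect (meager G).
  left; apply: meagerS (meagerU mG mP); rewrite EGP.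
  by move=> x [[Gx _]|[Px _]]; [left|right].
right.
(* [{classic A}] is [A] with a decidable equality, required to change a
   single coordinate. *)
pose K : {classic A} -> topologicalType := X.
have [s [f [bf fG nmf]]] : exists s f,
    [/\ @basic_box _ K s f, box f `<=` G & ~ meager (box f)].
  apply: contrapT => nobox; apply: nmG.
  apply: meagerS meager_bigcup_open => x Gx.
  have [s [f [bf fx fG]]] := @basic_box_nbhs _ K G x oG Gx.
  exists (box f) => //; split; first exact: (open_box bf).
  by apply: contrapT => nmf; apply: nobox; exists s, f.
apply: (@meager_from_box _ K s f) => //.
- by move=> i; exact: separable_W_space_base.
- move=> i x t nEx Ext; apply: nEx; apply: (tailE x _ _).2 Ext.
  apply: (@sub_finite_set _ _ [set i]); last exact: finite_set1.
  move=> j /= xj; have [//|ij] := @eqVneq {classic A} j i.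
  by case: xj; rewrite (@set_coord_out _ K) // eq_sym.
- apply: meagerS mP => x [/fG Gx]; rewrite EGP => nE.
  by apply: contrapT => nPx; apply: nE; left.
Qed.
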